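(* Let $V$ be a finite-dimensional space of linear forms over $\mathbb{C}$, $k\ge1$, and let $f \in S^d V$ be a homogeneous polynomial of degree $d$ lying in $\overline{RB}_k$. Then either $f \in RB_k$, or $\underline{\mathsf{WR}}(f) \le O(d^{3k+2})$ (the implied constant may depend on $k$).
   Context: A homogeneous polynomial $f\in S^dV$ is in $RB_k$ if $f=\prod_{i=1}^d \ell_i + \prod_{i=1}^d \ell'_i$ for some linear forms $\ell_i,\ell'_i\in V$ with $\mathrm{rank}(\ell'_1,\ldots,\ell'_d)\le k$ (the dimension of their span). It is in $\overline{RB}_k$ if $f=\lim_{\varepsilon\to0}\big(\prod_{i=1}^d\ell_i(\varepsilon)+\prod_{i=1}^d\ell'_i(\varepsilon)\big)$ for some linear forms $\ell_i(\varepsilon),\ell'_i(\varepsilon)$ whose coefficients are Laurent polynomials in $\varepsilon$, such that $\mathrm{rank}(\ell'_1(\varepsilon),\ldots,\ell'_d(\varepsilon))\le k$ for every $\varepsilon\neq0$. The border Waring rank $\underline{\mathsf{WR}}(f)$ is the smallest $r$ with $f=\lim_{\varepsilon\to0}\sum_{i=1}^r \ell_i(\varepsilon)^d$ for linear forms with coefficients in $\mathbb{C}(\varepsilon)$. *)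

(* Defs.v *)
From HB Require Import structures.
From mathcomp Require Import all_boot all_order all_algebra.
From mathcomp Require Import mpoly.
From mathcomp Require Import topology normedtype.
Set Implicit Arguments.
Unset Strict Implicit.
Unset Printing Implicit Defensive.
Import Order.TTheory GRing.Theory Num.Theory.
Import numFieldNormedType.Exports.
Local Open Scope classical_set_scope.
Local Open Scope ring_scope.

(* The space V of linear forms has a basis 'X_0, ..., 'X_(n-1), so S^d V is the
   space of d.-homog polynomials of {mpoly K[n]}.  A family of d linear forms is
   a matrix L : 'M[K]_(d, n): row i holds the coefficients of the i-th form, and
   the rank of the family (the dimension of its span) is \rank L. *)

Definition linform (K : numFieldType) (n : nat) (v : 'rV[K]_n) : {mpoly K[n]} :=
  \sum_(j < n) v 0 j *: 'X_j.

Definition prodform (K : numFieldType) (d n : nat) (L : 'M[K]_(d, n)) :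
    {mpoly K[n]} :=
  \prod_(i < d) linform (row i L).

(* F e --> f as e --> 0, e != 0, in the topology of the field K, coefficient by
   coefficient; for F e and f in S^d V this is convergence in that
   finite-dimensional space. *)
Definition poly_lim0 (K : numFieldType) (n : nat) (F : K -> {mpoly K[n]})
    (f : {mpoly K[n]}) : Prop :=
  forall m : 'X_{1.. n}, (fun e : K => (F e)@_m) @ (0 : K)^' --> f@_m.

(* The value at 0 is irrelevant: poly_lim0 is a punctured limit. *)
Definition laurent_fun (K : numFieldType) (a : K -> K) : Prop :=
  exists (p : {poly K}) (N : nat), forall e : K, e != 0 -> a e = p.[e] / e ^+ N.

(* The values at the finitely many zeros of q are irrelevant for limits. *)
Definition rational_fun (K : numFieldType) (a : K -> K) : Prop :=
  exists p q : {poly K},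
    q != 0 /\ forall e : K, q.[e] != 0 -> a e = p.[e] / q.[e].

Definition RB (K : numFieldType) (n d k : nat) (f : {mpoly K[n]}) : Prop :=
  exists L L' : 'M[K]_(d, n),
    (\rank L' <= k)%N /\ f = prodform L + prodform L'.

Definition border_RB (K : numFieldType) (n d k : nat) (f : {mpoly K[n]}) : Prop :=
  exists L L' : K -> 'M[K]_(d, n),
    [/\ forall i j, laurent_fun (fun e => L e i j),
        forall i j, laurent_fun (fun e => L' e i j),
        forall e, e != 0 -> (\rank (L' e) <= k)%N
      & poly_lim0 (fun e => prodform (L e) + prodform (L' e)) f].

Definition border_waring_decomp (K : numFieldType) (n d : nat)
    (f : {mpoly K[n]}) (r : nat) : Prop :=
  exists L : K -> 'M[K]_(r, n),
    (forall i j, rational_fun (fun e => L e i j)) /\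
    poly_lim0 (fun e => \sum_(i < r) linform (row i (L e)) ^+ d) f.

(* A relation "the border Waring rank of f is r".  The degree d is explicit
   because it is not determined by f when f = 0. *)
Definition is_border_waring_rank (K : numFieldType) (n d : nat)
    (f : {mpoly K[n]}) (r : nat) : Prop :=
  border_waring_decomp d f r /\
  forall s : nat, border_waring_decomp d f s -> (r <= s)%N.

(* Main.v *)
Require Import Defs.
From HB Require Import structures.
From mathcomp Require Import all_boot all_order all_algebra.
From mathcomp Require Import ring zify.
From mathcomp Require Import mpoly complex reals.
From mathcomp Require Import boolp classical_sets filter topology normedtype.
Set Implicit Arguments.
Unset Strict Implicit.
Unset Printing Implicit Defensive.
Import Order.TTheory GRing.Theory Num.Theory.
Import numFieldNormedType.Exports.
Local Open Scope classical_set_scope.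
Local Open Scope ring_scope.

(** Write the approximating family as [e^a P(e) + e^b Q(e)], where [P(e)] and
    [Q(e)] are products of linear forms that do not vanish at [e = 0].  If
    [a, b >= 0] both products converge and the limit lies in [RB].  Otherwise the
    poles cancel, so [a = b = -M < 0].

    Choose a point [u] at which no factor of [P(0)] or [Q(0)] vanishes, and
    normalize the factors to forms [x_i], [y_i] with value 1 at [u]; put
    [P1 = prod_i (1 + t x_i)] and [Q1 = prod_i (1 + t y_i)].  Expanding
    along the line [u + t X], the family becomes [e^-M (A P1 + B Q1)], whose
    coefficients all converge, and the coefficient of [t^d] is the original
    family.  Since [P1 - Q1 = O(e^M)], one may replace [P1 / Q1 - 1] by
    [log P1 - log Q1 = sum_i (log (1 + t x_i) - log (1 + t y_i))] up to an error
    [O(e^2M)].  Hence the limit is that of a sum of [d] forms of degree [d], the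
    [i]-th of which depends only on [x_i] and on at most [k] forms spanning the
    [y_j].  Each such form is a combination of the [d]-th powers of the
    [(d+1)^(k+1)] combinations with coefficients in [{0, ..., d}]. *)

(** * Interpolation nodes and logarithmic derivatives *)

Section Nodes.
Variables (K : numFieldType) (D : nat).

(** The nodes 0, ..., D are distinct in characteristic 0, so their Vandermonde matrix is invertible
    and the weights solve a linear system. *)
Lemma vandermonde_moments (tau : nat -> K) :
  exists v : 'I_D.+1 -> K,
    forall m, (m <= D)%N -> \sum_(a < D.+1) v a * a%:R ^+ m = tau m.
Proof.
pose V := Vandermonde D.+1 (\row_(a < D.+1) (a%:R : K)).
have Vu : V \in unitmx.
  rewrite unitmxE det_Vandermonde unitfE; apply/prodf_neq0 => i _.
  apply/prodf_neq0 => j ltij; rewrite !mxE subr_eq0 eqr_nat.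
  by rewrite gtn_eqF.
pose x := invmx V *m (\col_m tau m) : 'cV_D.+1.
exists (fun a => x a 0) => m lemD.
have /matrixP/(_ (inord m) 0) : V *m x = \col_m tau m by rewrite mulKVmx.
rewrite !mxE inordK // => <-; apply: eq_bigr => a _.
by rewrite !mxE inordK // mulrC.
Qed.

Variable S : comAlgType K.

Lemma sum_nodes_horner (tau : nat -> K) (v : 'I_D.+1 -> K) (g : {poly S}) :
    (forall m, (m <= D)%N -> \sum_(a < D.+1) v a * a%:R ^+ m = tau m) ->
    (size g <= D.+1)%N ->
  \sum_(a < D.+1) v a *: g.[a%:R] = \sum_(m < D.+1) tau m *: g`_m.
Proof.
move=> vP sg.
under eq_bigr => a _ do rewrite (horner_coef_wide _ sg) scaler_sumr.
rewrite exchange_big; apply: eq_bigr => m _ /=.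
rewrite -vP; last by rewrite -ltnS.
rewrite scaler_suml; apply: eq_bigr => a _.
by rewrite -scalerA -natrX -[in RHS]natrX scaler_nat mulr_natr.
Qed.

(** On polynomials of degree at most D, the derivative at c is the linear functional with moments m
    c^(m-1), hence a weighted sum of values at the nodes. The weights do not depend on [g]. *)
Lemma deriv_nodes (c : nat) :
  exists v : 'I_D.+1 -> K, forall g : {poly S}, (size g <= D.+1)%N ->
    g^`().[c%:R] = \sum_(a < D.+1) v a *: g.[a%:R].
Proof.
have [v vP] := vandermonde_moments (fun m => m%:R * c%:R ^+ m.-1).
exists v => g sg; rewrite (sum_nodes_horner vP sg).
rewrite big_ord_recl mul0r scale0r add0r.
have sg' : (size g^`() <= D)%N.
  have [->|g0] := eqVneq g 0; first by rewrite deriv0 size_poly0.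
  by rewrite -ltnS (leq_trans _ sg) // lt_size_deriv.
rewrite (horner_coef_wide _ sg'); apply: eq_bigr => i _.
rewrite coef_deriv /= -natrX -[in RHS]natrX -natrM scaler_nat mulr_natr.
by rewrite mulrnA.
Qed.

(** Up to the factor j+1, the left side is the derivative at t = c of (z + t y)^(j+1), a polynomial
    in t of degree at most D. The weights are constants, the same for all [y] and [z]. *)
Lemma mul_power_nodes (c j : nat) : (j < D)%N ->
  exists v : 'I_D.+1 -> K, forall y z : S,
    (z + c%:R * y) ^+ j * y = \sum_(a < D.+1) v a *: (z + a%:R * y) ^+ j.+1.
Proof.
move=> jD; have [v vP] := deriv_nodes c.
exists (fun a => j.+1%:R^-1 * v a) => y z.
pose g : {poly S} := (z%:P + y *: 'X) ^+ j.+1.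
have gE x : g.[x] = (z + x * y) ^+ j.+1 by rewrite !hornerE mulrC.
have sg : (size g <= D.+1)%N.
  apply: leq_trans (size_poly_exp_leq _ _) _.
  rewrite ltnS; apply: leq_trans jD; rewrite -[leqRHS]mul1n leq_mul2r /=.
  rewrite -subn1 leq_subLR; apply: leq_trans (size_polyD _ _) _.
  rewrite geq_max (leq_trans (size_polyC_leq1 _)) //.
  by rewrite (leq_trans (size_scale_leq _ _)) ?size_polyX.
under eq_bigr => a _ do rewrite -gE -scalerA.
rewrite -scaler_sumr -vP // deriv_exp derivD derivC add0r derivZ derivX.
rewrite alg_polyC /= hornerMn !hornerE.
rewrite -[X in _ *: X]scaler_nat scalerA mulVf ?scale1r ?pnatr_eq0 //.
by rewrite mulrC [c%:R * y]mulrC.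
Qed.

End Nodes.

Lemma power_nodes_id (K : numFieldType) (d : nat) : (0 < d)%N ->
  exists v : 'I_d.+1 -> K, forall t : K,
    \sum_(c < d.+1) v c * (t + c%:R) ^+ d = t.
Proof.
move=> d0.
(* In the binomial expansion of (t + c)^d the term linear in t is d t c^(d-1). These moments keep
   that term, divide it by d, and kill all others. *)
have [v vP] := vandermonde_moments d (fun m => (m == d.-1)%:R / d%:R : K).
exists v => t.
under eq_bigr => c _ do rewrite exprDn mulr_sumr.
rewrite exchange_big /= (bigD1 (inord d.-1)) //= [X in _ + X]big1 => [|m neq].
  rewrite addr0; have E : (inord d.-1 : 'I_d.+1) = d.-1 :> nat.
    by rewrite inordK // ltnS leq_pred.
  rewrite E -[X in (X - _)%N]prednK // subSnn expr1.
  under eq_bigr => c _ do rewrite mulrnAr mulrCA.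
  rewrite sumrMnl -mulr_sumr vP ?leq_pred // eqxx.
  rewrite -[X in _ *+ 'C(X, _)]prednK // binSn prednK // mul1r -mulrnAr.
  by rewrite -[_ *+ _]mulr_natr mulVf ?mulr1 ?pnatr_eq0 -?lt0n.
under eq_bigr => c _ do rewrite mulrnAr mulrCA.
rewrite sumrMnl -mulr_sumr vP; last by rewrite -ltnS.
suff /negPf-> : (m : nat) != d.-1 by rewrite mul0r mulr0 mul0rn.
apply: contra neq => /eqP E; apply/eqP/val_inj.
by rewrite /= inordK // -?E ?ltn_ord.
Qed.

(** * Truncated logarithmic derivatives of products of factors 1 + x t *)

Section LogDerivative.
Variables (S : comNzRingType) (d : nat).
Implicit Types (x y : 'I_d -> S).

Definition prod1X x : {poly S} := \prod_(i < d) (1 + x i *: 'X).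

(** Truncation below degree N of the series P'/P = sum_i x_i / (1 + x_i t), where P is [prod1X x];
    its coefficients are signed power sums. *)
Definition logderiv N x : {poly S} :=
  \poly_(m < N) ((-1) ^+ m * \sum_(i < d) x i ^+ m.+1).

Lemma logderivE N x :
  logderiv N x = \sum_(i < d) x i *: \sum_(m < N) (- (x i *: 'X)) ^+ m.
Proof.
rewrite /logderiv poly_def.
under eq_bigr => m _ do rewrite mulr_sumr scaler_suml.
rewrite exchange_big; apply: eq_bigr => i _; rewrite scaler_sumr /=.
apply: eq_bigr => m _.
rewrite -scaleNr exprZn scalerA;
by rewrite [in RHS]exprNn exprS mulrCA.
Qed.

(** Induction on the factors: each contributes x_i / (1 + x_i t), and the truncated geometric series
    inverts 1 + x_i t modulo t^N. [R] collects the remainders. *)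
Lemma prod1X_deriv N x :
  exists R, (prod1X x)^`() = prod1X x * logderiv N x + 'X^N * R.
Proof.
rewrite logderivE /prod1X.
apply: (big_rec2 (fun P L => exists R, P^`() = P * L + 'X^N * R)).
  by exists 0; rewrite -polyC1 derivC !mulr0 addr0.
move=> i P L _ [R PE].
exists ((1 + x i *: 'X) * R + (x i * (- x i) ^+ N) *: P).
rewrite derivM PE -polyC1 derivD derivC add0r derivZ derivX.
set G := \sum_(m < N) _.
have GE : (1 + x i *: 'X) * G = 1 - (- x i) ^+ N *: 'X^N.
  rewrite -exprZn scaleNr -[1 in RHS](expr1n _ N) subrXX opprK; congr (_ * _).
  by apply: eq_bigr => m _; rewrite expr1n mul1r.
rewrite polyC1; move: GE; rewrite -!mul_polyC !polyCM mulr1.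
set a := (x i)%:P; set b := ((- x i) ^+ N)%:P => GE.
(* The added last summand is a multiple of the relation [GE], hence zero; with it the goal becomes a
   ring identity. *)
transitivity (a * P + (1 + a * 'X) * (P * L + 'X^N * R) +
   a * P * ((1 + a * 'X) * G - (1 - b * 'X^N))); last by ring.
by rewrite GE subrr mulr0 addr0.
Qed.

Lemma prod1X0 x : (prod1X x)`_0 = 1.
Proof.
rewrite -horner_coef0 horner_prod big1 // => i _.
by rewrite !hornerE ?mulr0 ?addr0.
Qed.

Lemma size_prod1X_top x :
  (size (prod1X x) <= d.+1)%N /\ (prod1X x)`_d = \prod_(i < d) x i.
Proof.
(* Writing [d] as a sum of ones lets one recursion carry the number of factors along with the
   product and its top coefficient. *)
have dE : (\sum_(i < d) 1 = d)%N by rewrite sum_nat_const card_ord muln1.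
pose T (P : {poly S}) n q := (size P <= n.+1)%N /\ P`_n = q.
suff : T (prod1X x) (\sum_(i < d) 1)%N (\prod_(i < d) x i) by rewrite dE.
apply: (big_rec3 T); first by split; rewrite ?size_poly1 ?coef1.
move=> i q n P _ [sP Pn]; rewrite /T mulrDl mul1r -scalerAl.
split; last first.
  by rewrite add1n coefD coefZ coefXM /= Pn nth_default ?add0r.
apply: leq_trans (size_polyD _ _) _.
rewrite geq_max (leq_trans sP) //= (leq_trans (size_scale_leq _ _)) //.
by apply: leq_trans (size_polyMleq _ _) _; rewrite size_polyX !ltnS.
Qed.

Variables (N : nat) (w : S) (x y : 'I_d -> S) (L : {poly S}).
Let P := prod1X x.
Let Q := prod1X y.
Let delta : {poly S} := w *: (logderiv N x - logderiv N y).
Let D : {poly S} := w *: (P - Q).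
Let E : {poly S} := Q * L.

(** With p and q the two truncated logarithmic derivatives, P' = P p and Q' = Q q modulo t^N, and w
    (P p - Q q) = w (P - Q) p + Q w (p - q). *)
Lemma prod1X_diff_deriv j : (j < N)%N ->
  (D^`())`_j = (D * logderiv N x)`_j + (Q * delta)`_j.
Proof.
move=> jN; have [R1 PE] := prod1X_deriv N x; have [R2 QE] := prod1X_deriv N y.
rewrite derivZ derivB PE QE /D /delta.
have -> : w *: (P * logderiv N x + 'X^N * R1 - (Q * logderiv N y + 'X^N * R2))
  = w *: (P - Q) * logderiv N x + Q * (w *: (logderiv N x - logderiv N y))
   + (w%:P * (R1 - R2)) * 'X^N by rewrite -!mul_polyC; ring.
by rewrite !coefD coefMXn jN addr0.
Qed.

Hypothesis LE : L^`() = delta.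

(** Modulo t^N both D' = D p + Q delta and E' = E q + Q delta, so the difference satisfies (D - E)'
    = D p - E q = (D - E) q + D (p - q). The last term is of second order when P and Q are close. *)
Lemma prod1X_error_deriv j : (j < N)%N ->
  ((D - E)^`())`_j =
  ((D - E) * logderiv N y)`_j + (D * (logderiv N x - logderiv N y))`_j.
Proof.
move=> jN; have [R2 QE] := prod1X_deriv N y.
rewrite derivB coefB (prod1X_diff_deriv jN) /E derivM LE QE.
have -> : (prod1X y * logderiv N y + 'X^N * R2) * L + prod1X y * delta =
  E * logderiv N y + prod1X y * delta + R2 * L * 'X^N.
  by rewrite /E /Q; ring.
have -> : (D - E) * logderiv N y = D * logderiv N x - E * logderiv N y
    - D * (logderiv N x - logderiv N y) by ring.
by rewrite !coefB !coefD coefMXn jN addr0 /Q /D /P; ring.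
Qed.

End LogDerivative.

(** * Limits at zero *)

Section ScalarLimits.
Variable K : numFieldType.
Implicit Types (a b : K -> K) (p q : {poly K}).

Lemma cvg0_near a b (l : K) :
  (\forall e \near (0 : K)^', a e = b e) -> a @ (0 : K)^' --> l ->
  b @ (0 : K)^' --> l.
Proof. by move=> ab al; apply: cvg_trans al; apply: near_eq_cvg. Qed.

Lemma cvg0_sum (I : Type) (r : seq I) (P : pred I) (a : I -> K -> K)
    (l : I -> K) :
  (forall i, P i -> a i @ (0 : K)^' --> l i) ->
  (fun e => \sum_(i <- r | P i) a i e) @ (0 : K)^' --> \sum_(i <- r | P i) l i.
Proof.
move=> al; elim: r => [|i r IH].
  apply: cvg0_near (cvg_cst _); apply: nearW => e.
  by rewrite !big_nil.
rewrite big_cons; case: ifPn => Pi.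
  apply: cvg0_near (cvgD (al i Pi) IH).
  by apply: nearW => e; rewrite big_cons Pi.
by apply: cvg0_near IH; apply: nearW => e; rewrite big_cons (negPf Pi).
Qed.

Lemma cvg0_prod (I : Type) (r : seq I) (P : pred I) (a : I -> K -> K)
    (l : I -> K) :
  (forall i, P i -> a i @ (0 : K)^' --> l i) ->
  (fun e => \prod_(i <- r | P i) a i e) @ (0 : K)^' --> \prod_(i <- r | P i) l i.
Proof.
move=> al; elim: r => [|i r IH].
  apply: cvg0_near (cvg_cst _); apply: nearW => e.
  by rewrite !big_nil.
rewrite big_cons; case: ifPn => Pi.
  apply: cvg0_near (cvgM (al i Pi) IH).
  by apply: nearW => e; rewrite big_cons Pi.
by apply: cvg0_near IH; apply: nearW => e; rewrite big_cons (negPf Pi).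
Qed.

Lemma near0_neq0 : \forall e \near (0 : K)^', e != 0.
Proof. exact: nbhs_dnbhs_neq. Qed.

Lemma near0_ex (P : K -> Prop) : (\forall e \near (0 : K)^', P e) -> exists e, P e.
Proof. by move=> nP; have [e] := filter_ex nP; exists e. Qed.

Lemma cvg0_id : (fun e : K => e) @ (0 : K)^' --> (0 : K).
Proof. by apply: cvg_within_filter; exact: cvg_id. Qed.

Lemma cvg0_horner p : (fun e => p.[e]) @ (0 : K)^' --> p.[0].
Proof.
rewrite horner_coef.
apply: (@cvg0_near (fun e => \sum_(i < size p) p`_i * \prod_(j < i) e)).
  by apply: nearW => e; rewrite horner_coef; apply: eq_bigr => i _;
     rewrite prodr_const card_ord.
apply: cvg0_sum => i _; apply: cvgM; first exact: cvg_cst.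
rewrite -[X in 0 ^+ X]card_ord -prodr_const.
by apply: cvg0_prod => j _; exact: cvg0_id.
Qed.

Lemma near0_cvg_neq0 a (l : K) : l != 0 -> a @ (0 : K)^' --> l ->
  \forall e \near (0 : K)^', a e != 0.
Proof. by move=> l0 al; exact: cvgr_neq0 al l0. Qed.

Lemma poly_Xn_factor p : p != 0 -> exists N q, p = q * 'X^N /\ q.[0] != 0.
Proof.
move=> p0; have [N [q qp ->]] := multiplicity_XsubC p 0.
by exists N, q; rewrite subr0 -rootE; split; last by move: qp; rewrite p0.
Qed.

(** After a power of ['X] is split off, the cofactor is nonzero at 0, hence nearby by continuity. *)
Lemma near0_horner_neq0 p : p != 0 -> \forall e \near (0 : K)^', p.[e] != 0.
Proof.
move=> /poly_Xn_factor[N [q [-> q0]]].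
apply: filterS2 _ near0_neq0 (near0_cvg_neq0 q0 (@cvg0_horner q)) => e e0 qe.
by rewrite hornerM hornerXn mulf_neq0 ?expf_neq0.
Qed.

Lemma cvg0_unique a (l l' : K) :
  a @ (0 : K)^' --> l -> a @ (0 : K)^' --> l' -> l = l'.
Proof. by apply: cvg_unique; exact: norm_hausdorff. Qed.

Lemma cvg0_expn0 M : (0 < M)%N -> (fun e : K => e ^+ M) @ (0 : K)^' --> (0 : K).
Proof.
move=> M0; have := @cvg0_horner 'X^M; rewrite hornerXn expr0n eqn0Ngt M0 /=.
by apply: cvg0_near; apply: nearW => e; rewrite hornerXn.
Qed.

End ScalarLimits.

Section PolyLimits.
Variables (K : numFieldType) (n : nat).
Implicit Types (F G : K -> {mpoly K[n]}) (f g : {mpoly K[n]}).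

Lemma poly_lim0_near F G f :
  (\forall e \near (0 : K)^', F e = G e) -> poly_lim0 F f -> poly_lim0 G f.
Proof.
move=> FG Ff m; apply: cvg0_near (Ff m).
by apply: filterS FG => e ->.
Qed.

Lemma poly_lim0_ext F G f : F =1 G -> poly_lim0 F f -> poly_lim0 G f.
Proof. by move=> FG; apply: poly_lim0_near; apply: nearW. Qed.

Lemma poly_lim0_cst f : poly_lim0 (fun=> f) f.
Proof. by move=> m; exact: cvg_cst. Qed.

Lemma poly_lim0D F G f g : poly_lim0 F f -> poly_lim0 G g ->
  poly_lim0 (fun e => F e + G e) (f + g).
Proof.
move=> Ff Gg m; rewrite mcoeffD.
by apply: cvg0_near (cvgD (Ff m) (Gg m)); apply: nearW => e; rewrite mcoeffD.
Qed.

Lemma poly_lim0Z (a : K -> K) (l : K) F f : a @ (0 : K)^' --> l ->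
  poly_lim0 F f -> poly_lim0 (fun e => a e *: F e) (l *: f).
Proof.
move=> al Ff m; rewrite mcoeffZ.
by apply: cvg0_near (cvgM al (Ff m)); apply: nearW => e; rewrite mcoeffZ.
Qed.

Lemma poly_lim0N F f : poly_lim0 F f -> poly_lim0 (fun e => - F e) (- f).
Proof.
move=> Ff; rewrite -scaleN1r.
by apply: poly_lim0_ext (poly_lim0Z (cvg_cst _) Ff) => e; rewrite scaleN1r.
Qed.

Lemma poly_lim0B F G f g : poly_lim0 F f -> poly_lim0 G g ->
  poly_lim0 (fun e => F e - G e) (f - g).
Proof. by move=> Ff Gg; apply: poly_lim0D => //; apply: poly_lim0N. Qed.

Lemma poly_lim0M F G f g : poly_lim0 F f -> poly_lim0 G g ->
  poly_lim0 (fun e => F e * G e) (f * g).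
Proof.
move=> Ff Gg m; rewrite mcoeffM.
apply: (@cvg0_near _ (fun e => \sum_(k : 'X_{1..n < (mdeg m).+1, (mdeg m).+1} |
    m == (k.1 + k.2)%MM) (F e)@_k.1 * (G e)@_k.2)).
  by apply: nearW => e; rewrite mcoeffM.
by apply: cvg0_sum => k _; apply: cvgM; [exact: Ff | exact: Gg].
Qed.

Lemma poly_lim0_sum (I : Type) (r : seq I) (P : pred I)
    (F : I -> K -> {mpoly K[n]}) (f : I -> {mpoly K[n]}) :
  (forall i, P i -> poly_lim0 (F i) (f i)) ->
  poly_lim0 (fun e => \sum_(i <- r | P i) F i e) (\sum_(i <- r | P i) f i).
Proof.
move=> Ff m; rewrite raddf_sum /=.
apply: (@cvg0_near _ (fun e => \sum_(i <- r | P i) (F i e)@_m)).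
  by apply: nearW => e; rewrite raddf_sum.
by apply: cvg0_sum => i Pi; exact: Ff.
Qed.

Lemma poly_lim0_prod (I : Type) (r : seq I) (P : pred I)
    (F : I -> K -> {mpoly K[n]}) (f : I -> {mpoly K[n]}) :
  (forall i, P i -> poly_lim0 (F i) (f i)) ->
  poly_lim0 (fun e => \prod_(i <- r | P i) F i e) (\prod_(i <- r | P i) f i).
Proof.
move=> Ff; elim: r => [|i r IH].
  rewrite big_nil; apply: (@poly_lim0_ext (fun=> 1)); last exact: poly_lim0_cst.
  by move=> e; rewrite big_nil.
rewrite big_cons; case: ifPn => Pi.
  by apply: poly_lim0_ext (poly_lim0M (Ff i Pi) IH) => e; rewrite big_cons Pi.
by apply: poly_lim0_ext IH => e; rewrite big_cons (negPf Pi).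
Qed.

Lemma poly_lim0_unique F f g : poly_lim0 F f -> poly_lim0 F g -> f = g.
Proof. by move=> Ff Fg; apply/mpolyP => m; exact: cvg0_unique (Ff m) (Fg m). Qed.

(** Under a uniform degree bound only finitely many monomials occur, and a linear map on a
    finite-dimensional space is continuous. *)
Lemma poly_lim0_linear (T : {linear {mpoly K[n]} -> {mpoly K[n]}}) d F f :
  (forall e, (msize (F e) <= d)%N) -> (msize f <= d)%N ->
  poly_lim0 F f -> poly_lim0 (fun e => T (F e)) (T f).
Proof.
move=> sF sf Ff.
have TE p : (msize p <= d)%N ->
    T p = \sum_(m : 'X_{1.. n < d}) p@_m *: T 'X_[m].
  move=> /mpolywE {1}->; rewrite linear_sum; apply: eq_bigr => m _.
  by rewrite linearZ.
rewrite (TE f sf).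
apply: (@poly_lim0_ext (fun e =>
    \sum_(m : 'X_{1.. n < d}) (F e)@_m *: T 'X_[m])) => [e|]; first by rewrite TE.
apply: poly_lim0_sum => m _.
by apply: poly_lim0Z (Ff m) _; exact: poly_lim0_cst.
Qed.

End PolyLimits.

(** * Rational families and spans of powers *)

Section RationalFunctions.
Variable K : numFieldType.
Implicit Types (a b : K -> K) (p q : {poly K}).

Lemma rational_ext a b : a =1 b -> rational_fun a -> rational_fun b.
Proof. by move=> ab [p [q [q0 E]]]; exists p, q; split=> // e qe; rewrite -ab E. Qed.

Lemma rational_horner p : rational_fun (fun e => p.[e]).
Proof.
exists p, 1; split=> [|e _]; first exact: oner_neq0.
by rewrite hornerC divr1.
Qed.

Lemma rational_cst (c : K) : rational_fun (fun=> c).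
Proof. by apply: rational_ext (rational_horner c%:P) => e; rewrite hornerC. Qed.

Lemma rationalD a b : rational_fun a -> rational_fun b ->
  rational_fun (fun e => a e + b e).
Proof.
move=> [p [q [q0 aE]]] [p' [q' [q'0 bE]]].
exists (p * q' + p' * q), (q * q'); split=> [|e]; first exact: mulf_neq0.
rewrite hornerM mulf_eq0 negb_or => /andP[qe q'e].
by rewrite aE // bE // addf_div // hornerD !hornerM.
Qed.

Lemma rationalM a b : rational_fun a -> rational_fun b ->
  rational_fun (fun e => a e * b e).
Proof.
move=> [p [q [q0 aE]]] [p' [q' [q'0 bE]]].
exists (p * p'), (q * q'); split=> [|e]; first exact: mulf_neq0.
rewrite hornerM mulf_eq0 negb_or => /andP[qe q'e].
by rewrite aE // bE // mulf_div !hornerM.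
Qed.

Lemma rationalV a : rational_fun a -> rational_fun (fun e => (a e)^-1).
Proof.
move=> [p [q [q0 aE]]]; have [p0|p0] := eqVneq p 0.
  exists 0, q; split=> // e qe.
  by rewrite aE // p0 horner0 !mul0r invr0.
(* The fraction q/p is expanded by q: where the denominator is nonzero, q must be nonzero too for
   the formula for [a] to apply. *)
exists (q * q), (p * q); split=> [|e]; first exact: mulf_neq0.
rewrite !hornerM mulf_eq0 negb_or => /andP[pe qe].
by rewrite aE // invf_div -mulf_div divff // mulr1.
Qed.

Lemma rational_sum (I : Type) (r : seq I) (P : pred I) (a : I -> K -> K) :
  (forall i, P i -> rational_fun (a i)) ->
  rational_fun (fun e => \sum_(i <- r | P i) a i e).
Proof.
move=> aP; elim: r => [|i r IH].
  by apply: rational_ext (rational_cst 0) => e; rewrite big_nil.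
case Pi: (P i).
  by apply: rational_ext (rationalD (aP i Pi) IH) => e; rewrite big_cons Pi.
by apply: rational_ext IH => e; rewrite big_cons Pi.
Qed.

End RationalFunctions.

Section Linform.
Variables (K : numFieldType) (n : nat).
Implicit Types u v : 'rV[K]_n.

Lemma linformD u v : linform (u + v) = linform u + linform v.
Proof.
by rewrite /linform -big_split; apply: eq_bigr => j _; rewrite mxE scalerDl.
Qed.

Lemma linformZ a u : linform (a *: u) = a *: linform u.
Proof.
by rewrite /linform scaler_sumr; apply: eq_bigr => j _; rewrite mxE scalerA.
Qed.

Lemma linform0 : linform (0 : 'rV[K]_n) = 0.
Proof. by rewrite -(scale0r (0 : 'rV[K]_n)) linformZ scale0r. Qed.

Lemma linform_sum (I : Type) (r : seq I) (P : pred I) (u : I -> 'rV[K]_n) :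
  linform (\sum_(i <- r | P i) u i) = \sum_(i <- r | P i) linform (u i).
Proof. exact: (big_morph _ linformD linform0). Qed.

End Linform.

Section PowerSpan.
Variables (K : numFieldType) (n N D : nat).
Variable y : 'I_N -> K -> {mpoly K[n]}.
Implicit Types (G H : K -> {mpoly K[n]}) (c : {ffun 'I_N -> 'I_D.+1}).

Definition gridform c e : {mpoly K[n]} := \sum_(s < N) (c s)%:R *: y s e.

(** The span over rational functions of e of the j-th powers of the grid forms. The same grid serves
    every degree j up to D, so degrees can be raised one at a time. *)
Definition powspan (j : nat) G :=
  exists a : {ffun 'I_N -> 'I_D.+1} -> K -> K,
    (forall c, rational_fun (a c)) /\
    forall e, G e = \sum_c a c e *: gridform c e ^+ j.

Lemma powspan_ext j G H : G =1 H -> powspan j G -> powspan j H.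
Proof. by move=> GH [a [aR E]]; exists a; split=> // e; rewrite -GH E. Qed.

Lemma powspan_pow j c : powspan j (fun e => gridform c e ^+ j).
Proof.
exists (fun c' => fun=> (c' == c)%:R); split=> [c'|e].
  exact: rational_cst.
rewrite (bigD1 c) //= eqxx scale1r big1 ?addr0 // => c' /negPf->.
by rewrite scale0r.
Qed.

Lemma powspan0 j : powspan j (fun=> 0).
Proof.
exists (fun _ => fun=> 0); split=> [c|e]; first exact: rational_cst.
by rewrite big1 // => c _; rewrite scale0r.
Qed.

Lemma powspanD j G H : powspan j G -> powspan j H ->
  powspan j (fun e => G e + H e).
Proof.
move=> [a [aR aE]] [b [bR bE]]; exists (fun c e => a c e + b c e); split=> [c|e].
  exact: rationalD.
by rewrite aE bE -big_split; apply: eq_bigr => c _; rewrite scalerDl.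
Qed.

Lemma powspanZ j (b : K -> K) G : rational_fun b -> powspan j G ->
  powspan j (fun e => b e *: G e).
Proof.
move=> bR [a [aR aE]]; exists (fun c e => b e * a c e); split=> [c|e].
  exact: rationalM.
by rewrite aE scaler_sumr; apply: eq_bigr => c _; rewrite scalerA.
Qed.

Lemma powspan_sum j (I : Type) (r : seq I) (P : pred I)
    (G : I -> K -> {mpoly K[n]}) :
  (forall i, P i -> powspan j (G i)) ->
  powspan j (fun e => \sum_(i <- r | P i) G i e).
Proof.
move=> GP; elim: r => [|i r IH].
  by apply: powspan_ext (powspan0 j) => e; rewrite big_nil.
case Pi: (P i).
  by apply: powspan_ext (powspanD (GP i Pi) IH) => e; rewrite big_cons Pi.
by apply: powspan_ext IH => e; rewrite big_cons Pi.
Qed.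

Lemma powspan1 : powspan 0 (fun=> 1).
Proof.
by apply: powspan_ext (powspan_pow 0 [ffun=> ord0]) => e; rewrite expr0.
Qed.

(** For one power of a grid form, let only the coordinate [c s] run through 0, ..., D. By
    [mul_power_nodes] the product with [y s] is a combination of the (j+1)-st powers on this line,
    which stays inside the grid. *)
Lemma powspan_mul j s G : (j < D)%N -> powspan j G ->
  powspan j.+1 (fun e => y s e * G e).
Proof.
move=> jD [a [aR aE]].
apply: (@powspan_ext _ (fun e => \sum_c a c e *: (gridform c e ^+ j * y s e))).
  move=> e; rewrite aE mulr_sumr; apply: eq_bigr => c _.
  by rewrite -scalerAr mulrC.
apply: powspan_sum => c _; apply: powspanZ => //.
have [v vP] := mul_power_nodes {mpoly K[n]} (c s) jD.
pose c' (i : 'I_D.+1) := [ffun t => if t == s then i else c t].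
pose z e : {mpoly K[n]} := \sum_(t < N | t != s) (c t)%:R *: y t e.
have gE i e : gridform (c' i) e = z e + i%:R * y s e.
  rewrite /gridform (bigD1 s) //= ffunE eqxx addrC scaler_nat mulr_natl.
  congr (_ + _); apply: eq_bigr => t /negPf ts.
  by rewrite ffunE ts.
have gcE e : gridform c e = z e + (c s)%:R * y s e.
  by rewrite /gridform (bigD1 s) //= addrC scaler_nat mulr_natl.
apply: (@powspan_ext _ (fun e =>
    \sum_(i < D.+1) v i *: gridform (c' i) e ^+ j.+1)).
  move=> e; rewrite gcE vP; apply: eq_bigr => i _.
  by rewrite gE.
apply: powspan_sum => i _; apply: powspanZ; first exact: rational_cst.
exact: powspan_pow.
Qed.

Definition ratcomb (x : K -> {mpoly K[n]}) :=
  exists b : 'I_N -> K -> K, (forall s, rational_fun (b s)) /\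
    forall e, x e = \sum_(s < N) b s e *: y s e.

Lemma powspan_mul_ratcomb j x G : (j < D)%N -> ratcomb x -> powspan j G ->
  powspan j.+1 (fun e => x e * G e).
Proof.
move=> jD [b [bR bE]] GS.
apply: (@powspan_ext _ (fun e => \sum_s b s e *: (y s e * G e))).
  move=> e; rewrite bE mulr_suml; apply: eq_bigr => s _.
  by rewrite -scalerAl.
by apply: powspan_sum => s _; apply: powspanZ => //; apply: powspan_mul.
Qed.

Lemma powspan_mul_ratcombX j m x G : (j + m <= D)%N -> ratcomb x ->
  powspan j G -> powspan (j + m) (fun e => x e ^+ m * G e).
Proof.
elim: m => [|m IH]; first rewrite addn0 => jD xR.
  by apply: powspan_ext => e; rewrite mul1r.
rewrite addnS => jD xR GS.
apply: powspan_ext (powspan_mul_ratcomb jD xR (IH (ltnW jD) xR GS)) => e.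
by rewrite exprS mulrA.
Qed.

(** The coefficient is an elementary symmetric polynomial. Splitting off one factor, coefficient j
    of (1 + x t) R is R_j + x R_(j-1), and the second summand is handled by
    [powspan_mul_ratcomb]. *)
Lemma powspan_prod1X d (x : 'I_d -> K -> {mpoly K[n]}) j : (j <= D)%N ->
  (forall i, ratcomb (x i)) ->
  powspan j (fun e => (prod1X (fun i => x i e))`_j).
Proof.
move=> jD xR; rewrite /prod1X; elim: (index_enum _) j jD => [|i r IH] j jD.
  case: j jD => [|j] _.
    by apply: powspan_ext powspan1 => e; rewrite big_nil coef1.
  by apply: powspan_ext (powspan0 _) => e; rewrite big_nil coef1.
case: j jD => [|j] jD.
  apply: powspan_ext (IH 0%N jD) => e.
  by rewrite big_cons mulrDl mul1r -scalerAl coefD coefZ coefXM mulr0 addr0.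
apply: powspan_ext (powspanD (IH _ jD)
  (powspan_mul_ratcomb jD (xR i) (IH _ (ltnW jD)))) => e.
by rewrite big_cons mulrDl mul1r -scalerAl coefD coefZ coefXM.
Qed.

End PowerSpan.

(** * From spans of powers to border Waring decompositions *)

Section WaringCount.

Lemma border_waring_decomp_fin (K : numFieldType) (n d : nat) (I : finType)
    (l : I -> K -> 'rV[K]_n) (f : {mpoly K[n]}) :
  (forall i j, rational_fun (fun e => l i e 0 j)) ->
  poly_lim0 (fun e => \sum_i linform (l i e) ^+ d) f ->
  border_waring_decomp d f #|I|.
Proof.
move=> lR lf; exists (fun e => \matrix_(i, j) l (enum_val i) e 0 j); split.
  move=> i j; apply: rational_ext (lR (enum_val i) j) => e.
  by rewrite mxE.
apply: poly_lim0_ext lf => e.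
rewrite (reindex _ (onW_bij _ (@enum_val_bij I))); apply: eq_bigr => i _.
by congr (linform _ ^+ _); apply/rowP => j; rewrite !mxE.
Qed.

(* The scalars are absorbed into [d.+1] powers by writing [t] as a constant
   combination of the powers [(t + c) ^+ d]: a rational function need not have
   a rational [d]-th root, a constant does. *)
Lemma powspan_border_waring (K : numClosedFieldType) (n d N : nat)
    (I : finType) (Y : I -> 'I_N -> K -> 'rV[K]_n)
    (G : I -> K -> {mpoly K[n]}) f :
  (0 < d)%N ->
  (forall i s j, rational_fun (fun e => Y i s e 0 j)) ->
  (forall i, powspan d (fun s e => linform (Y i s e)) d (G i)) ->
  poly_lim0 (fun e => \sum_i G i e) f ->
  border_waring_decomp d f (#|I| * (d.+1 ^ N * d.+1)).
Proof.
move=> d0 YR GS Gf; have [v vP] := power_nodes_id K d0.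
have [a aP] := choice GS.
(* The d-th power of this form is v_t (a + t)^d times the d-th power of the grid form; summation
   over the node t leaves the scalar a. *)
pose l (ict : I * ({ffun 'I_N -> 'I_d.+1} * 'I_d.+1)) e : 'rV[K]_n :=
  (d.-root (v ict.2.2) * (a ict.1 ict.2.1 e + ict.2.2%:R)) *:
    \sum_(s < N) (ict.2.1 s)%:R *: Y ict.1 s e.
have -> : (#|I| * (d.+1 ^ N * d.+1) =
    #|{: I * ({ffun 'I_N -> 'I_d.+1} * 'I_d.+1)}|)%N.
  by rewrite !card_prod card_ffun !card_ord.
apply: (border_waring_decomp_fin (l := l)) => [[i [c t]] j|].
  apply: (@rational_ext _ (fun e => d.-root (v t) * (a i c e + t%:R) *
      \sum_(s < N) (c s)%:R * Y i s e 0 j)).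
    move=> e; rewrite !mxE summxE; congr (_ * _).
    by apply: eq_bigr => s _; rewrite mxE.
  apply: rationalM.
    apply: rationalM; first exact: rational_cst.
    by apply: rationalD; [case: (aP i) | exact: rational_cst].
  by apply: rational_sum => s _; apply: rationalM => //; exact: rational_cst.
apply: poly_lim0_ext Gf => e.
rewrite -(pair_bigA_idem _ (fun i ct => linform (l (i, ct) e) ^+ d)) /=;
  last by rewrite addr0.
apply: eq_bigr => i _; rewrite (aP i).2.
rewrite -(pair_bigA_idem _ (fun c t => linform (l (i, (c, t)) e) ^+ d)) /=;
  last by rewrite addr0.
apply: eq_bigr => c _.
rewrite -[in LHS](vP (a i c e)) scaler_suml; apply: eq_bigr => t _.
rewrite /l linformZ exprZn exprMn rootCK //; congr (_ *: _ ^+ _).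
by rewrite linform_sum; apply: eq_bigr => s _; rewrite linformZ.
Qed.

End WaringCount.

(** * Linearization of a difference of products *)

Section Convergent.
Variables (K : numFieldType) (n : nat).
Implicit Types F G : K -> {mpoly K[n]}.

Definition cvgp F := exists f, poly_lim0 F f.
Definition nullp F := poly_lim0 F 0.

Lemma cvgp_ext F G : F =1 G -> cvgp F -> cvgp G.
Proof. by move=> FG [f Ff]; exists f; apply: poly_lim0_ext Ff. Qed.

Lemma cvgp_near F G : (\forall e \near (0 : K)^', F e = G e) -> cvgp F -> cvgp G.
Proof. by move=> FG [f Ff]; exists f; apply: poly_lim0_near Ff. Qed.

Lemma cvgp_cst f : cvgp (fun=> f).
Proof. by exists f; exact: poly_lim0_cst. Qed.

Lemma cvgp_eq_cst f F : (forall e, F e = f) -> cvgp F.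
Proof.
move=> Ff; exists f => m; apply: cvg0_near (cvg_cst _).
by apply: nearW => e; rewrite Ff.
Qed.

Lemma cvgpD F G : cvgp F -> cvgp G -> cvgp (fun e => F e + G e).
Proof. by move=> [f Ff] [g Gg]; exists (f + g); exact: poly_lim0D. Qed.

Lemma cvgpB F G : cvgp F -> cvgp G -> cvgp (fun e => F e - G e).
Proof. by move=> [f Ff] [g Gg]; exists (f - g); exact: poly_lim0B. Qed.

Lemma cvgpM F G : cvgp F -> cvgp G -> cvgp (fun e => F e * G e).
Proof. by move=> [f Ff] [g Gg]; exists (f * g); exact: poly_lim0M. Qed.

Lemma cvgpZ (a : K -> K) (l : K) F : a @ (0 : K)^' --> l -> cvgp F ->
  cvgp (fun e => a e *: F e).
Proof. by move=> al [f Ff]; exists (l *: f); exact: poly_lim0Z. Qed.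

Lemma cvgpMn F m : cvgp F -> cvgp (fun e => F e *+ m).
Proof.
move=> Fc; apply: cvgp_ext (cvgpZ (cvg_cst (m%:R : K)) Fc) => e.
by rewrite scaler_nat.
Qed.

Lemma cvgpX F m : cvgp F -> cvgp (fun e => F e ^+ m).
Proof.
move=> Fc; elim: m => [|m IH]; first exact: cvgp_cst.
by apply: cvgp_ext (cvgpM Fc IH) => e; rewrite exprS.
Qed.

Lemma cvgp_sum (I : Type) (r : seq I) (P : pred I) (F : I -> K -> {mpoly K[n]}) :
  (forall i, P i -> cvgp (F i)) -> cvgp (fun e => \sum_(i <- r | P i) F i e).
Proof.
move=> FP; elim: r => [|i r IH].
  by apply: (@cvgp_eq_cst 0) => e; rewrite big_nil.
case Pi: (P i).
  by apply: cvgp_ext (cvgpD (FP i Pi) IH) => e; rewrite big_cons Pi.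
by apply: cvgp_ext IH => e; rewrite big_cons Pi.
Qed.

Lemma nullp_sum (I : Type) (r : seq I) (P : pred I) (F : I -> K -> {mpoly K[n]}) :
  (forall i, P i -> nullp (F i)) -> nullp (fun e => \sum_(i <- r | P i) F i e).
Proof. by move=> FP; have := poly_lim0_sum (r := r) FP; rewrite big1. Qed.

Lemma nullpD F G : nullp F -> nullp G -> nullp (fun e => F e + G e).
Proof. by move=> F0 G0; have := poly_lim0D F0 G0; rewrite addr0. Qed.

Lemma nullpB F G : nullp F -> nullp G -> nullp (fun e => F e - G e).
Proof. by move=> F0 G0; have := poly_lim0B F0 G0; rewrite subr0. Qed.

Lemma nullpM F G : nullp F -> cvgp G -> nullp (fun e => F e * G e).
Proof. by move=> F0 [g Gg]; have := poly_lim0M F0 Gg; rewrite mul0r. Qed.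

Lemma nullpZ (a : K -> K) (l : K) F : a @ (0 : K)^' --> l -> nullp F ->
  nullp (fun e => a e *: F e).
Proof. by move=> al F0; have := poly_lim0Z al F0; rewrite scaler0. Qed.

Lemma nullpZl (a : K -> K) F : a @ (0 : K)^' --> (0 : K) -> cvgp F ->
  nullp (fun e => a e *: F e).
Proof. by move=> a0 [f Ff]; have := poly_lim0Z a0 Ff; rewrite scale0r. Qed.

Variables (d : nat).

Lemma cvgp_prod1X (x : 'I_d -> K -> {mpoly K[n]}) j :
  (forall i, cvgp (x i)) -> cvgp (fun e => (prod1X (fun i => x i e))`_j).
Proof.
move=> xc; rewrite /prod1X; elim: (index_enum _) j => [|i r IH] j.
  by apply: (@cvgp_eq_cst (1 : {poly {mpoly K[n]}})`_j) => e; rewrite big_nil.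
case: j => [|j].
  apply: cvgp_ext (IH 0%N) => e.
  by rewrite big_cons mulrDl mul1r -scalerAl coefD coefZ coefXM mulr0 addr0.
apply: cvgp_ext (cvgpD (IH j.+1) (cvgpM (xc i) (IH j))) => e.
by rewrite big_cons mulrDl mul1r -scalerAl coefD coefZ coefXM.
Qed.

Lemma cvgp_logderiv N (x : 'I_d -> K -> {mpoly K[n]}) j :
  (forall i, cvgp (x i)) -> cvgp (fun e => (logderiv N (fun i => x i e))`_j).
Proof.
move=> xc; case: (ltnP j N) => jN; last first.
  by apply: (@cvgp_eq_cst 0) => e; rewrite coef_poly ltnNge jN.
apply: (@cvgp_ext (fun e => (-1) ^+ j * \sum_(i < d) x i e ^+ j.+1)).
  by move=> e; rewrite coef_poly jN.
apply: cvgpM; first exact: cvgp_cst.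
by apply: cvgp_sum => i _; apply: cvgpX.
Qed.

(** The truncation at degree d of w (log P - log Q), obtained by integrating termwise. Since the
    inverse of 0 is 0, the constant term vanishes. *)
Definition logdiff (w : K) (x y : 'I_d -> {mpoly K[n]}) : {poly {mpoly K[n]}} :=
  \poly_(m < d.+1)
    (m%:R^-1 *: (w *: (logderiv d x - logderiv d y)`_m.-1)).

Lemma logdiff_deriv w x y :
  (logdiff w x y)^`() = w%:MP *: (logderiv d x - logderiv d y).
Proof.
apply/polyP => j; rewrite coef_deriv coef_poly ltnS coefZ mul_mpolyC.
case: ltnP => jd /=; last first.
  by rewrite mul0rn coefB !coef_poly ltnNge jd subrr scaler0.
by rewrite -scaler_nat scalerA divff ?scale1r ?pnatr_eq0.
Qed.

(** The power sums separate the indices i; this is what later splits the limit into d summands, each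
    involving a single x_i. *)
Lemma logdiff_coef w x y m : (m <= d)%N ->
  (logdiff w x y)`_m = (m%:R^-1 * (w * (-1) ^+ m.-1)) *:
    (\sum_(i < d) x i ^+ m - \sum_(i < d) y i ^+ m).
Proof.
move=> md; rewrite coef_poly ltnS md.
case: m md => [|m] md; first by rewrite invr0 mul0r !scale0r.
rewrite coefB !coef_poly md -mulrBr -!mul_mpolyC !mpolyCM rmorphXn rmorphN1 /=.
by rewrite !mulrA.
Qed.

Variables (x y : 'I_d -> K -> {mpoly K[n]}) (w v : K -> K).
Hypothesis (xc : forall i, cvgp (x i)) (yc : forall i, cvgp (y i)).
Hypothesis (v0 : v @ (0 : K)^' --> (0 : K)).
Hypothesis (vw : \forall e \near (0 : K)^', v e * w e = 1).

Let P e := prod1X (fun i => x i e).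
Let Q e := prod1X (fun i => y i e).
Let D e : {poly {mpoly K[n]}} := (w e)%:MP *: (P e - Q e).
Let delta e : {poly {mpoly K[n]}} :=
  (w e)%:MP *: (logderiv d (fun i => x i e) - logderiv d (fun i => y i e)).
Let L e := logdiff (w e) (fun i => x i e) (fun i => y i e).
Let E e := Q e * L e.

Section DiffCvg.
Hypothesis Dc : forall j, (j <= d)%N -> cvgp (fun e => (D e)`_j).

(** Since Q has constant term 1, coefficient j of D' = D p + Q delta can be solved for delta_j in
    terms of D, p, Q and earlier coefficients of delta. *)
Lemma cvgp_delta j : (j < d)%N -> cvgp (fun e => (delta e)`_j).
Proof.
elim/ltn_ind: j => j IH jd.
apply: (@cvgp_ext (fun e => (D e)`_j.+1 *+ j.+1
    - (\sum_(i < j.+1) (D e)`_i * (logderiv d (fun i => x i e))`_(j - i))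
    - (\sum_(i < j) (Q e)`_i.+1 * (delta e)`_(j - i.+1)))).
  move=> e; rewrite -coef_deriv -coefM.
  rewrite (prod1X_diff_deriv (w e)%:MP (fun i => x i e) (fun i => y i e) jd).
  rewrite [(_ * delta e)`_j]coefM big_ord_recl /= subn0 prod1X0 mul1r.
  by rewrite [X in X - _ = _]addrAC subrr add0r addrK.
apply: cvgpB; first apply: cvgpB.
- by apply: cvgpMn; apply: Dc.
- apply: cvgp_sum => i _; apply: cvgpM; last exact: cvgp_logderiv.
  by apply: Dc; rewrite (leq_trans _ (ltnW jd)) // -ltnS.
- apply: cvgp_sum => i _; apply: cvgpM; first exact: cvgp_prod1X.
  have ltj : (j - i.+1 < j)%N by rewrite ltn_subrL /= (leq_ltn_trans _ (ltn_ord i)).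
  by apply: IH => //; exact: ltn_trans jd.
Qed.

(** Both constant terms vanish. Then [prod1X_error_deriv] gives (j+1) (D - E)_(j+1) as a sum of
    earlier errors times convergent factors, plus v times coefficient j of D delta, which tends to 0
    with v. *)
Lemma nullp_diff j : (j <= d)%N -> nullp (fun e => (D e - E e)`_j).
Proof.
elim/ltn_ind: j => -[_ _|j IH jd].
  apply: (@poly_lim0_ext _ _ (fun=> 0)) (@poly_lim0_cst _ _ 0) => e.
  rewrite coefB coefZ coefB !prod1X0 subrr mulr0 sub0r coefM big_ord1.
  by rewrite coef_poly /= invr0 scale0r mulr0 oppr0.
pose R e := \sum_(i < j.+1) (D e - E e)`_i * (logderiv d (fun i => y i e))`_(j - i)
  + v e *: \sum_(i < j.+1) (D e)`_i * (delta e)`_(j - i).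
apply: (@poly_lim0_near _ _ (fun e => j.+1%:R^-1 *: R e)).
  apply: filterS vw => e vwe.
  have -> : R e = (D e - E e)`_j.+1 *+ j.+1.
    rewrite -coef_deriv.
    rewrite (@prod1X_error_deriv _ _ d _ _ _ _ (logdiff_deriv _ _ _) _ jd).
    have -> : logderiv d (fun i => x i e) - logderiv d (fun i => y i e) =
        (v e)%:MP *: delta e.
      by rewrite /delta scalerA -mpolyCM vwe mpolyC1 scale1r.
    by rewrite -scalerAr coefZ mul_mpolyC /R -!coefM.
  by rewrite -[X in _ *: X]scaler_nat scalerA mulVf ?scale1r ?pnatr_eq0.
apply: nullpZ; first exact: cvg_cst.
apply: nullpD; last apply: nullpZl => //.
  apply: nullp_sum => i _; apply: nullpM; last exact: cvgp_logderiv.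
  by apply: IH => //; rewrite (leq_trans _ (ltnW jd)) // -ltnS.
apply: cvgp_sum => i _; apply: cvgpM.
  by apply: Dc; rewrite (leq_trans _ (ltnW jd)) // -ltnS.
by apply: cvgp_delta; rewrite (leq_ltn_trans (leq_subr _ _)).
Qed.

End DiffCvg.

Variables (A B : K -> K) (B0 : K) (f : {mpoly K[n]}).
Hypothesis (BB0 : B @ (0 : K)^' --> B0) (B0_neq0 : B0 != 0).
Let F j e := w e *: (A e *: (P e)`_j + B e *: (Q e)`_j).
Hypothesis Fc : forall j, (j <= d)%N -> cvgp (F j).

(** With s = w (A + B), the family is s P_d - B D_d. Replacing P_d by Q_d costs s v D_d, and
    replacing D_d by E_d costs B (D - E)_d; both errors tend to 0. *)
Lemma poly_lim0_linearize : poly_lim0 (F d) f ->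
  poly_lim0 (fun e => (w e * (A e + B e)) *: (Q e)`_d - B e *: (E e)`_d) f.
Proof.
move=> Ff.
pose s e := w e * (A e + B e).
(* P and Q have constant term 1, so [F 0 e] is the constant polynomial s(e). *)
have [l sl] : exists l : K, s @ (0 : K)^' --> l.
  have [g Fg] := Fc (leq0n d); exists g@_0; apply: cvg0_near (Fg 0%MM).
  apply: nearW => e; rewrite /F !prod1X0 -scalerDl scalerA mcoeffZ mcoeff1 eqxx.
  by rewrite mulr1.
have DE j e : (D e)`_j = w e *: ((P e)`_j - (Q e)`_j).
  by rewrite coefZ mul_mpolyC coefB.
have FE j e : F j e = s e *: (P e)`_j - B e *: (D e)`_j.
  by rewrite DE /F /s -!mul_mpolyC !mpolyCM mpolyCD; ring.
(* The identity [FE] is solved for D_j; division by B is harmless because its limit is nonzero. *)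
have Dc j : (j <= d)%N -> cvgp (fun e => (D e)`_j).
  move=> jd.
  apply: (@cvgp_near (fun e => (B e)^-1 *: (s e *: (P e)`_j - F j e))).
    apply: filterS (near0_cvg_neq0 B0_neq0 BB0) => e Be.
    by rewrite FE subKr scalerA mulVf ?scale1r.
  apply: cvgpZ (cvgV B0_neq0 BB0) _; apply: cvgpB; last exact: Fc.
  by apply: cvgpZ sl _; exact: cvgp_prod1X.
have h1 : nullp (fun e => s e *: ((P e)`_d - (Q e)`_d)).
  apply: nullpZ sl _; apply: poly_lim0_near (nullpZl v0 (Dc d (leqnn d))).
  by apply: filterS vw => e vwe; rewrite DE scalerA vwe scale1r.
have h2 := nullpZ BB0 (nullp_diff Dc (leqnn d)).
have := poly_lim0B Ff (nullpB h1 h2); rewrite subr0; apply: poly_lim0_ext => e.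
rewrite FE coefB !scalerBr -/(s e).
set a := s e *: _; set b := B e *: _; set c := s e *: _; set g := B e *: _.
ring.
Qed.

End Convergent.

(** * Polynomial and Laurent matrices *)

Section RankMinors.
Variables (K : fieldType) (m n : nat).

Lemma rank_minor (B : 'M[K]_(m, n)) :
  exists (f : 'I_(\rank B) -> 'I_m) (g : 'I_(\rank B) -> 'I_n),
    mxsub f g B \in unitmx.
Proof.
pose C := rowsub (maxrankfun B) B.
have Cf : row_full C^T.
  rewrite -col_leq_rank mxrank_tr; have := maxrowsub_free B.
  by rewrite /row_free => /eqP->.
exists (maxrankfun B), (fullrankfun Cf).
rewrite -unitmx_tr -row_free_unit /row_free -[X in _ == X](mxrank_fullrowsub Cf).
by apply/eqP; congr (\rank _); apply/matrixP => i j; rewrite !mxE.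
Qed.

Lemma rank_mxsub r s (f : 'I_r -> 'I_m) (g : 'I_s -> 'I_n) (B : 'M[K]_(m, n)) :
  (\rank (mxsub f g B) <= \rank B)%N.
Proof.
rewrite mxsubrc; apply: leq_trans (mxrankS (rowsub_sub _ _)) _.
rewrite -mxrank_tr -[leqRHS]mxrank_tr trmx_mxsub.
exact: mxrankS (rowsub_sub _ _).
Qed.

(* Rows [f] and columns [g] carry an invertible minor of maximal size, so every
   row is the combination of the rows [f] that is right on the columns [g]. *)
Lemma row_from_minor r (f : 'I_r -> 'I_m) (g : 'I_r -> 'I_n) (B : 'M[K]_(m, n)) :
  mxsub f g B \in unitmx -> (\rank B <= r)%N ->
  B = colsub g B *m invmx (mxsub f g B) *m rowsub f B.
Proof.
move=> fgU rB; have rf : (r <= \rank (rowsub f B))%N.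
  have : \rank (mxsub f g B) = r by apply/eqP; rewrite -/(row_free _) row_free_unit.
  move=> {1}<-; rewrite mxsubcr -[leqRHS]mxrank_tr -mxrank_tr trmx_mxsub.
  exact: mxrankS (rowsub_sub _ _).
have /submxP[X BX] : (B <= rowsub f B)%MS.
  rewrite -(geq_leqif (mxrank_leqif_sup (rowsub_sub f B))).
  exact: leq_trans rB rf.
have -> : colsub g B = X *m mxsub f g B.
  by rewrite {1}BX [in RHS]mxsubcr mulmx_colsub.
by rewrite mulmxK.
Qed.

End RankMinors.

(** * Rank of a polynomial matrix near 0 *)

Section PolynomialMatrix.
Variables (K : numFieldType) (d n : nat) (A : 'M[{poly K}]_(d, n)).

Definition evmx m1 m2 (B : 'M[{poly K}]_(m1, m2)) (e : K) : 'M[K]_(m1, m2) :=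
  map_mx (horner_eval e) B.

Lemma det_minor_neq0 r (f : 'I_r -> 'I_d) (g : 'I_r -> 'I_n) e0 :
  mxsub f g (evmx A e0) \in unitmx -> \det (mxsub f g A) != 0.
Proof.
rewrite -map_mxsub unitmxE det_map_mx unitfE.
by apply: contraNneq => ->; rewrite rmorph0.
Qed.

(** The point [e0] may be far from 0: a minor nonzero at one point is a nonzero polynomial in e, and
    so has no zeros in a punctured neighbourhood of 0. *)
Lemma near_minor_unit r (f : 'I_r -> 'I_d) (g : 'I_r -> 'I_n) e0 :
  mxsub f g (evmx A e0) \in unitmx ->
  \forall e \near (0 : K)^', mxsub f g (evmx A e) \in unitmx.
Proof.
move=> /det_minor_neq0/near0_horner_neq0; apply: filterS => e.
by rewrite -map_mxsub unitmxE det_map_mx unitfE.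
Qed.

Lemma unit_minor_rank r (f : 'I_r -> 'I_d) (g : 'I_r -> 'I_n) e :
  mxsub f g (evmx A e) \in unitmx -> (r <= \rank (evmx A e))%N.
Proof.
move=> U; apply: leq_trans (rank_mxsub f g _).
by move: U; rewrite -row_free_unit /row_free => /eqP->.
Qed.

Variable k : nat.
Hypothesis rankA : forall e, e != 0 -> (\rank (evmx A e) <= k)%N.

(** Semicontinuity of rank: an invertible minor of maximal size at 0 remains invertible at some
    nonzero e. *)
Lemma rank_evmx0 : (\rank (evmx A 0) <= k)%N.
Proof.
have [f [g U]] := rank_minor (evmx A 0).
have [e []] := near0_ex (filterI (near0_neq0 K) (near_minor_unit U)).
by move=> e0 /unit_minor_rank/leq_trans; apply; exact: rankA.
Qed.

(** Take a nonzero [e0] where the rank is maximal, and an invertible minor of that size. Near 0 the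
    minor is still invertible and the rank is no larger, so its rows span the others, with rational
    coefficients by Cramer's rule. *)
Lemma rational_row_basis :
  exists (r : nat) (f : 'I_r -> 'I_d) (c : 'I_d -> 'I_r -> K -> K),
  [/\ (r <= k)%N, forall i s, rational_fun (c i s) &
    \forall e \near (0 : K)^', forall i,
      row i (evmx A e) = \sum_(s < r) c i s e *: row (f s) (evmx A e)].
Proof.
pose attained r := `[< exists2 e : K, e != 0 & \rank (evmx A e) = r >].
have ex_att : exists r, attained r.
  by exists (\rank (evmx A 1)); apply/asboolP; exists 1; rewrite ?oner_neq0.
have bnd_att r : attained r -> (r <= k)%N.
  by move=> /asboolP[e e0 <-]; exact: rankA.
case: (ex_maxnP ex_att bnd_att) => r /asboolP[e0 e00 <-] rmax.
have [f [g U]] := rank_minor (evmx A e0).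
set r' := \rank _ in f g U rmax *.
pose S := mxsub f g A.
(* Entries of [colsub g A *m invmx S], with the inverse written as adjugate over determinant. *)
exists r', f, (fun i s e =>
  \sum_(t < r') (A i (g t)).[e] * ((\det S).[e]^-1 * (\adj S t s).[e])).
split; first exact: rankA.
  move=> i s; apply: rational_sum => t _; apply: rationalM.
    exact: rational_horner.
  apply: rationalM; last exact: rational_horner.
  by apply: rationalV; exact: rational_horner.
apply: filterS2 _ (near0_neq0 K) (near_minor_unit U) => e e_neq0 Ue i.
have re : (\rank (evmx A e) <= r')%N by apply: rmax; apply/asboolP; exists e.
rewrite [in LHS](row_from_minor Ue re) row_mul mulmx_sum_row.
apply: eq_bigr => s _; rewrite row_rowsub; congr (_ *: _).
rewrite mxE mxE; apply: eq_bigr => t _; rewrite !mxE; congr (_ * _).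
rewrite /invmx Ue mxE; congr (_ * _).
  by rewrite -map_mxsub det_map_mx.
by rewrite -map_mxsub -map_mx_adj !mxE.
Qed.

End PolynomialMatrix.

Section LaurentNormalForm.
Variables (K : numFieldType).

(** The entries are brought over a common denominator e^M, and then the largest power of e dividing
    all numerators is factored out, so that some entry survives at 0. *)
Lemma laurent_row n (a : K -> 'rV[K]_n) :
  (forall j, laurent_fun (fun e => a e 0 j)) ->
  (forall e, e != 0 -> a e = 0) \/
  exists (z : int) (p : 'rV[{poly K}]_n),
    evmx p 0 != 0 /\ forall e, e != 0 -> a e = e ^ z *: evmx p e.
Proof.
move=> /choice[p0] /choice[N aE].
pose M := (\sum_j N j)%N.
have NM j : (N j <= M)%N by rewrite /M (bigD1 j) //= leq_addr.
pose p j := p0 j * 'X^(M - N j).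
have paE e j : e != 0 -> a e 0 j = e ^- M * (p j).[e].
  move=> e0; rewrite aE // /p hornerM hornerXn mulrCA; congr (_ * _).
  rewrite -[X in _ = e ^- X * _](subnK (NM j)) exprD invfM mulrAC mulVf ?mul1r //.
  exact: expf_neq0.
have [p_eq0|] := pselect (forall j, p j = 0).
  by left=> e e0; apply/rowP => j; rewrite paE // p_eq0 horner0 mulr0 mxE.
move=> /existsNP[j0 /eqP pj0]; right.
have ex_m : exists m, [exists j, (p j)`_m != 0].
  exists (size (p j0)).-1; apply/existsP; exists j0.
  by rewrite -/(lead_coef _) lead_coef_eq0.
case: (ex_minnP ex_m) => m /existsP[j pjm] m_min.
exists (m%:Z - M%:Z), (\row_j drop_poly m (p j)); split.
  apply/eqP => /rowP/(_ j)/eqP.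
  by rewrite !mxE /horner_eval horner_coef0 coef_drop_poly add0n (negPf pjm).
move=> e e0; apply/rowP => i; rewrite paE // !mxE /horner_eval.
rewrite -[in LHS](poly_take_drop m (p i)) [take_poly _ _](_ : _ = 0).
  rewrite add0r hornerM hornerXn expfzDr // -exprnN -exprnP.
  by rewrite mulrCA mulrC [e ^- M * _]mulrC.
apply/polyP => l; rewrite coef_take_poly coef0; case: ltnP => // lm.
apply/eqP; apply: contraLR lm => pl; rewrite -leqNgt m_min //.
by apply/existsP; exists i.
Qed.

End LaurentNormalForm.

(** * Products of linear forms *)

Section ProductForms.
Variables (K : numFieldType) (n : nat).

Lemma linform_neq0 (v : 'rV[K]_n) : v != 0 -> linform v != 0.
Proof.
apply: contraNneq => lv0; apply/eqP/rowP => j; rewrite mxE.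
have : (linform v)@_(U_(j)) = 0 by rewrite lv0 mcoeff0.
rewrite /linform raddf_sum (bigD1 j) //= mcoeffZ mcoeffXU eqxx mulr1 big1 ?addr0 //.
by move=> i /negPf ij; rewrite mcoeffZ mcoeffXU ij mulr0.
Qed.

Lemma linform_homog (v : 'rV[K]_n) : linform v \is 1.-homog.
Proof.
by apply: rpred_sum => j _; apply: dhomogZ; rewrite dhomogX /= mdeg1.
Qed.

Lemma prodform_homog d (P : 'M[K]_(d, n)) : prodform P \is d.-homog.
Proof.
have prodP (r : seq 'I_d) : \prod_(i <- r) linform (row i P) \is (size r).-homog.
  elim: r => [|i r IH]; first by rewrite big_nil dhomog1.
  by rewrite big_cons /= -add1n dhomogM ?linform_homog.
by have := prodP (enum 'I_d); rewrite big_enum size_enum_ord.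
Qed.

Lemma homog_msize_le d (p : {mpoly K[n]}) : p \is d.-homog -> (msize p <= d.+1)%N.
Proof.
move=> /dhomogP pd; rewrite mmeasureE; apply/bigmax_leqP_seq => m mp _.
by rewrite (pd m mp).
Qed.

Lemma prodform0 d : (0 < d)%N -> prodform (0 : 'M[K]_(d, n)) = 0.
Proof.
case: d => // d _; rewrite /prodform big_ord_recl.
by rewrite (_ : row _ _ = 0) ?linform0 ?mul0r //; apply/rowP => j; rewrite !mxE.
Qed.

Lemma poly_lim0_linform m (P : 'M[{poly K}]_(m, n)) i :
  poly_lim0 (fun e => linform (row i (evmx P e))) (linform (row i (evmx P 0))).
Proof.
rewrite /linform; apply: poly_lim0_sum => j _.
apply: poly_lim0Z; last exact: poly_lim0_cst.
rewrite !mxE; apply: cvg0_near (@cvg0_horner K (P i j)).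
by apply: nearW => e; rewrite !mxE.
Qed.

Lemma poly_lim0_prodform d (P : 'M[{poly K}]_(d, n)) :
  poly_lim0 (fun e => prodform (evmx P e)) (prodform (evmx P 0)).
Proof. by apply: poly_lim0_prod => i _; exact: poly_lim0_linform. Qed.

(** If the family converged, multiplying it by e^(-z) would give H the limit 0 instead of [H0]. *)
Lemma pole_not_cvgp (z : int) (H : K -> {mpoly K[n]}) H0 :
  (z < 0)%R -> H0 != 0 -> poly_lim0 H H0 -> ~ cvgp (fun e => e ^ z *: H e).
Proof.
move=> z0 H0_neq0 HH0 Hc; case/eqP: H0_neq0.
have [N N0 zE] : exists2 N, (0 < N)%N & z = - N%:Z.
  by exists `|z|%N; lia.
apply: poly_lim0_unique HH0 _.
apply: poly_lim0_near (nullpZl (cvg0_expn0 N0) Hc).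
apply: filterS (near0_neq0 K) => e e0.
by rewrite scalerA zE -exprnN mulfV ?scale1r ?expf_neq0.
Qed.

(** Each row is normalized by [laurent_row] and the exponents add up. The clauses [0 < d] exclude
    the empty product, which is 1, wherever a zero product is needed later. *)
Lemma laurent_matrix d (L : K -> 'M[K]_(d, n)) :
  (forall i j, laurent_fun (fun e => L e i j)) ->
  (0 < d)%N /\ (forall e, e != 0 -> prodform (L e) = 0) \/
  exists (z : int) (P : 'M[{poly K}]_(d, n)),
  [/\ forall i, row i (evmx P 0) != 0,
      forall e, e != 0 -> prodform (L e) = e ^ z *: prodform (evmx P e),
      forall e, e != 0 -> (\rank (evmx P e) <= \rank (L e))%N &
      z != 0 -> (0 < d)%N].
Proof.
move=> LL; have rowL i : forall j, laurent_fun (fun e => row i (L e) 0 j).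
  move=> j; have [p [N pE]] := LL i j.
  by exists p, N => e e0; rewrite mxE pE.
have [[i0 i0_zero]|] :=
    pselect (exists i, forall e, e != 0 -> row i (L e) = 0).
  left; split; first exact: leq_ltn_trans (ltn_ord i0).
  move=> e e0; rewrite /prodform (bigD1 i0) //= i0_zero //.
  by rewrite linform0 mul0r.
move=> /forallNP nz; right.
have /choice[z /choice[p pP]] i : exists (z : int) (p : 'rV[{poly K}]_n),
    evmx p 0 != 0 /\ forall e, e != 0 -> row i (L e) = e ^ z *: evmx p e.
  by case: (laurent_row (rowL i)) => // /nz.
pose P := \matrix_i p i.
have rowP i e : row i (evmx P e) = evmx (p i) e.
  by rewrite /evmx -map_row rowK.
have rowLE i e : e != 0 -> row i (L e) = e ^ z i *: row i (evmx P e).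
  by move=> e0; rewrite rowP; case: (pP i) => _; apply.
exists (\sum_i z i), P; split.
- by move=> i; rewrite rowP; case: (pP i).
- move=> e e0; rewrite /prodform.
  rewrite (big_morph (fun z => e ^ z) (id1 := 1) (op1 := *%R)) //; last first.
    by move=> a b; rewrite expfzDr.
  rewrite -scaler_prod; apply: eq_bigr => i _.
  by rewrite rowLE // linformZ.
- move=> e e0.
  (* Rescaling the rows is left multiplication by a diagonal matrix, which cannot raise the rank. *)
  have -> : evmx P e = diag_mx (\row_i e ^ (- z i)) *m L e.
    apply/matrixP => i j; rewrite mul_diag_mx.
    have := congr1 (fun r : 'rV_n => r 0 j) (rowLE i e e0); rewrite !mxE => ->.
    by rewrite mulrA -expfzDr // addNr expr0z mul1r.
  exact: mxrankM_maxr.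
- by case: (posnP d) => // d0; subst d; rewrite big_ord0 eqxx.
Qed.

(* Either the product has a limit, which is again a product, or it has a pole
   whose leading coefficient is a nonzero product. *)
Lemma laurent_product_cases d (L : K -> 'M[K]_(d, n)) :
  (forall i j, laurent_fun (fun e => L e i j)) ->
  (exists M : 'M[K]_(d, n),
     (forall k, (forall e, e != 0 -> (\rank (L e) <= k)%N) -> (\rank M <= k)%N) /\
     poly_lim0 (fun e => prodform (L e)) (prodform M)) \/
  exists (z : int) (P : 'M[{poly K}]_(d, n)),
  [/\ (z < 0)%R /\ (0 < d)%N, forall i, row i (evmx P 0) != 0,
      forall e, e != 0 -> prodform (L e) = e ^ z *: prodform (evmx P e) &
      forall e, e != 0 -> (\rank (evmx P e) <= \rank (L e))%N].
Proof.
have near_lim (F G : K -> {mpoly K[n]}) f : (forall e, e != 0 -> F e = G e) ->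
    poly_lim0 G f -> poly_lim0 F f.
  move=> FG; apply: poly_lim0_near.
  by apply: filterS (near0_neq0 K) => e e0; rewrite FG.
move=> /laurent_matrix[[d0 L0]|[z [P [P0 LE rP dz]]]].
  left; exists 0; split=> [k _|]; first by rewrite mxrank0.
  rewrite prodform0 //; apply: near_lim L0 _; exact: poly_lim0_cst.
case: (ltrgtP z 0) => z0; last 1 first.
- left; exists (evmx P 0); split.
    by move=> k rL; apply: rank_evmx0 => e e0; exact: leq_trans (rP e e0) (rL e e0).
  apply: (near_lim _ _ _ _ (@poly_lim0_prodform d P)) => e e0.
  by rewrite LE // z0 expr0z scale1r.
- right; exists z, P; split=> //; split=> //.
  by apply: dz; rewrite lt_eqF.
- left; exists 0; split=> [k _|]; first by rewrite mxrank0.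
  have d0 : (0 < d)%N by apply: dz; rewrite gt_eqF.
  have [N N0 zE] : exists2 N, (0 < N)%N & z = N%:Z by exists `|z|%N; lia.
  rewrite prodform0 //; apply: (near_lim _ _ _ _
    (nullpZl (cvg0_expn0 N0) (ex_intro _ _ (@poly_lim0_prodform d P)))) => e e0.
  by rewrite LE // zE.
Qed.

End ProductForms.

(** * Expansion of products along a line through a point *)

Section Polarization.
Variables (K : numFieldType) (n : nat).
Implicit Types (u v : 'rV[K]_n).

Definition pairing u v : K := \sum_(l < n) v 0 l * u 0 l.

(** On the moment curve u = (1, t, t^2, ...) each pairing is a nonzero polynomial in t; any t
    outside the roots of their product works. *)
Lemma common_nonroot (I : finType) (v : I -> 'rV[K]_n) :
  (forall i, v i != 0) -> exists u, forall i, pairing u (v i) != 0.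
Proof.
move=> v0; pose q i : {poly K} := \sum_(l < n) v i 0 l *: 'X^l.
have q0 i : q i != 0.
  apply: contraNneq (v0 i) => qi; apply/eqP/rowP => l; rewrite mxE.
  have : (q i)`_l = 0 by rewrite qi coef0.
  rewrite coef_sum (bigD1 l) //= coefZ coefXn eqxx mulr1 big1 ?addr0 // => s sl.
  by rewrite coefZ coefXn -[_ == _ :> nat]/(l == s) eq_sym (negPf sl) mulr0.
have qq0 : \prod_i q i != 0 by apply/prodf_neq0 => i _.
have [t] := near0_ex (near0_horner_neq0 qq0).
rewrite horner_prod => /prodf_neq0 tP; exists (\row_l t ^+ l) => i.
have := tP i isT; rewrite horner_sum; congr (_ != 0).
by apply: eq_bigr => l _; rewrite hornerZ hornerXn mxE.
Qed.

Definition line_subst u : {mpoly K[n]} -> {poly {mpoly K[n]}} :=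
  mmap (@polyC {mpoly K[n]} \o @mpolyC n K)
       (fun l => (u 0 l)%:MP%:P + 'X_l *: 'X).

HB.instance Definition _ u := GRing.RMorphism.on (line_subst u).

(* Coefficient [j] of [p (u + t X)] as a polynomial in [t]. *)
Definition polarize u j (p : {mpoly K[n]}) : {mpoly K[n]} := (line_subst u p)`_j.

Lemma polarize_is_linear u j : linear (polarize u j).
Proof.
move=> a p q; rewrite /polarize /line_subst mmapD mmapZ coefD /=.
by rewrite coefCM mul_mpolyC.
Qed.

HB.instance Definition _ u j :=
  GRing.isLinear.Build K {mpoly K[n]} {mpoly K[n]} _ (polarize u j)
    (polarize_is_linear u j).

Lemma line_subst_linform u v :
  line_subst u (linform v) = (pairing u v)%:MP%:P + linform v *: 'X.
Proof.
rewrite /linform /pairing rmorph_sum /= !rmorph_sum scaler_suml -big_split.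
apply: eq_bigr => l _; rewrite /line_subst mmapZ mmapX mmap1U /= mulrDr.
by rewrite !rmorphM /= -mul_polyC -mul_mpolyC -mul_polyC rmorphM mulrA.
Qed.

(** At u + t X a factor l takes the value l(u) + t l = l(u) (1 + t l / l(u)), which is where the
    products [prod1X] come from. *)
Lemma polarize_prodform d u (P : 'M[K]_(d, n)) j :
  (forall i, pairing u (row i P) != 0) ->
  polarize u j (prodform P) = (\prod_i pairing u (row i P)) *:
    (prod1X (fun i => linform ((pairing u (row i P))^-1 *: row i P)))`_j.
Proof.
move=> u0; rewrite -mul_mpolyC -coefCM /polarize /prodform rmorph_prod /=.
apply: (congr1 (fun q : {poly {mpoly K[n]}} => q`_j)).
transitivity (\prod_(i < d) ((pairing u (row i P))%:MP%:P *
    (1 + linform ((pairing u (row i P))^-1 *: row i P) *: 'X) :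
      {poly {mpoly K[n]}})); last by rewrite big_split /= -!rmorph_prod.
apply: eq_bigr => i _.
rewrite line_subst_linform linformZ mulrDr mulr1; congr (_ + _).
by rewrite -mul_mpolyC -!mul_polyC mulrA -!rmorphM mulrA -rmorphM mulfV ?mul1r.
Qed.

Lemma prodform_prod1X d u (P : 'M[K]_(d, n)) :
  (forall i, pairing u (row i P) != 0) ->
  prodform P = (\prod_i pairing u (row i P)) *:
    (prod1X (fun i => linform ((pairing u (row i P))^-1 *: row i P)))`_d.
Proof.
move=> u0; rewrite (size_prod1X_top _).2 -scaler_prod; apply: eq_bigr => i _.
by rewrite linformZ scalerA mulfV ?scale1r.
Qed.

End Polarization.

(** * Cancelling poles *)

Section Normalization.
Variables (K : numFieldType) (n d : nat) (u : 'rV[K]_n).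

Definition pairing_poly (R : 'M[{poly K}]_(d, n)) i : {poly K} :=
  \sum_l u 0 l *: R i l.

Lemma pairing_polyE R i e :
  (pairing_poly R i).[e] = pairing u (row i (evmx R e)).
Proof.
by rewrite horner_sum; apply: eq_bigr => l _; rewrite hornerZ !mxE mulrC.
Qed.

Lemma prodform_normalize (R : 'M[{poly K}]_(d, n)) (x : 'I_d -> {mpoly K[n]}) e :
    (\prod_i pairing_poly R i).[e] != 0 ->
    (forall i, x i = linform ((pairing_poly R i).[e]^-1 *: row i (evmx R e))) ->
  prodform (evmx R e) = (\prod_i pairing_poly R i).[e] *: (prod1X x)`_d /\
  forall j, polarize u j (prodform (evmx R e)) =
    (\prod_i pairing_poly R i).[e] *: (prod1X x)`_j.
Proof.
rewrite !horner_prod => /prodf_neq0 a0 xE.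
have u0 i : pairing u (row i (evmx R e)) != 0 by rewrite -pairing_polyE a0.
have -> : prod1X x = prod1X (fun i =>
    linform ((pairing u (row i (evmx R e)))^-1 *: row i (evmx R e))).
  by apply: eq_bigr => i _; rewrite xE pairing_polyE.
have -> : \prod_i (pairing_poly R i).[e] = \prod_i pairing u (row i (evmx R e)).
  by apply: eq_bigr => i _; rewrite pairing_polyE.
split=> [|j]; first exact: prodform_prod1X.
exact: polarize_prodform.
Qed.

End Normalization.

Section PoleCase.
Variables (K : numClosedFieldType) (n d k M : nat) (P Q : 'M[{poly K}]_(d, n)).
Variable f : {mpoly K[n]}.
Hypotheses (d_gt0 : (0 < d)%N) (M_gt0 : (0 < M)%N) (f_homog : f \is d.-homog).
Hypotheses (P0 : forall i, row i (evmx P 0) != 0)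
  (Q0 : forall i, row i (evmx Q 0) != 0).
Hypothesis rankQ : forall e, e != 0 -> (\rank (evmx Q e) <= k)%N.
Hypothesis limf : poly_lim0
  (fun e => (e ^+ M)^-1 *: (prodform (evmx P e) + prodform (evmx Q e))) f.

(** Linearization presents f as the limit of a sum of d families, each in the span of d-th powers of
    grid forms in r + 1 linear forms; [powspan_border_waring] then counts the powers. *)
Lemma pole_case : exists2 r, (r <= k)%N &
  border_waring_decomp d f (d * (d.+1 ^ r.+1 * d.+1)).
Proof.
have [u uP] := @common_nonroot K n ('I_d + 'I_d)%type
  (fun s => match s with inl i => row i (evmx P 0) | inr i => row i (evmx Q 0) end)
  (fun s => match s with inl i => P0 i | inr i => Q0 i end).
have [r [g [c [rk cR cE]]]] := rational_row_basis rankQ.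
exists r => //.
pose al := pairing_poly u P; pose be := pairing_poly u Q.
have al0 i : (al i).[0] != 0 by rewrite pairing_polyE (uP (inl i)).
have be0 i : (be i).[0] != 0 by rewrite pairing_polyE (uP (inr i)).
pose A := \prod_i al i; pose B := \prod_i be i.
have A0 : A.[0] != 0 by rewrite horner_prod; apply/prodf_neq0 => i _.
have B0 : B.[0] != 0 by rewrite horner_prod; apply/prodf_neq0 => i _.
pose w e : K := (e ^+ M)^-1; pose v e : K := e ^+ M.
pose X i e := linform ((al i).[e]^-1 *: row i (evmx P e)).
(* The normalized rows of Q are rewritten in the row basis. They agree with the originals only near
   0, but lie in the span of the basis for every e, as [ratcomb] demands. *)
pose Y i e := linform ((be i).[e]^-1 *:
  \sum_(s < r) c i s e *: row (g s) (evmx Q e)).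
have nearA := near0_cvg_neq0 A0 (@cvg0_horner K A).
have nearB := near0_cvg_neq0 B0 (@cvg0_horner K B).
have nearY : \forall e \near (0 : K)^', forall i,
    Y i e = linform ((be i).[e]^-1 *: row i (evmx Q e)).
  by apply: filterS cE => e cEe i; rewrite /Y -cEe.
have cX (R : 'M[{poly K}]_(d, n)) (p : {poly K}) i : p.[0] != 0 ->
    cvgp (fun e => linform (p.[e]^-1 *: row i (evmx R e))).
  move=> p0; have h : cvgp (fun e => linform (row i (evmx R e))).
    by exists (linform (row i (evmx R 0))); exact: poly_lim0_linform.
  by apply: cvgp_ext (cvgpZ (cvgV p0 (@cvg0_horner K p)) h) => e; rewrite linformZ.
have Xc i : cvgp (X i) by apply: cX.
have Yc i : cvgp (Y i).
  apply: cvgp_near (cX Q (be i) i (be0 i)).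
  by apply: filterS nearY => e ->.
have v0 : v @ (0 : K)^' --> (0 : K) by exact: cvg0_expn0.
have vw : \forall e \near (0 : K)^', v e * w e = 1.
  by apply: filterS (near0_neq0 K) => e e0; rewrite /v /w mulfV ?expf_neq0.
pose PX e := prod1X (fun i => X i e); pose QY e := prod1X (fun i => Y i e).
have near_prod : \forall e \near (0 : K)^',
    (prodform (evmx P e) = A.[e] *: (PX e)`_d /\
      forall j, polarize u j (prodform (evmx P e)) = A.[e] *: (PX e)`_j) /\
    (prodform (evmx Q e) = B.[e] *: (QY e)`_d /\
      forall j, polarize u j (prodform (evmx Q e)) = B.[e] *: (QY e)`_j).
  apply: filterS3 nearA nearB nearY => e Ae Be YE; split.
    exact: prodform_normalize.
  exact: prodform_normalize.
(* Polarization is linear, hence continuous in bounded degree, so convergence of the given family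
   passes to all coefficients along the line. *)
have Fc j : (j <= d)%N ->
    cvgp (fun e => w e *: (A.[e] *: (PX e)`_j + B.[e] *: (QY e)`_j)).
  move=> _; exists (polarize u j f).
  have sF e : (msize (w e *: (prodform (evmx P e) + prodform (evmx Q e))) <= d.+1)%N.
    apply: homog_msize_le; apply: dhomogZ.
    by apply: dhomogD; exact: prodform_homog.
  have h := poly_lim0_linear (T := polarize u j) sF (homog_msize_le f_homog) limf.
  apply: poly_lim0_near h; apply: filterS near_prod => e [[_ PE] [_ QE]].
  by rewrite linearZ linearD /= PE QE.
have Ff : poly_lim0 (fun e => w e *: (A.[e] *: (PX e)`_d + B.[e] *: (QY e)`_d)) f.
  apply: poly_lim0_near limf; apply: filterS near_prod => e [[PE _] [QE _]].
  by rewrite PE QE.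
have lin := poly_lim0_linearize Xc Yc v0 vw (@cvg0_horner K B) B0 Fc Ff.
pose co (a : nat) e : K :=
  - (B.[e] * ((d - a)%:R^-1 * (w e * (-1) ^+ (d - a).-1))).
(* The term in Q_d is shared equally among the d indices; the rest is the i-th part of -B E_d, with
   E_d = sum_a Q_a L_(d-a). At a = d the coefficient is 0, again because the inverse of 0 is 0. *)
pose G i e : {mpoly K[n]} :=
  (w e * (A.[e] + B.[e]) / d%:R) *: (QY e)`_d +
  \sum_(a < d.+1) co a e *: ((QY e)`_a * (X i e ^+ (d - a) - Y i e ^+ (d - a))).
have limG : poly_lim0 (fun e => \sum_i G i e) f.
  apply: poly_lim0_ext lin => e.
  rewrite /G big_split /= sumr_const card_ord -scaler_nat scalerA.
  rewrite mulrCA mulfV ?pnatr_eq0 -?lt0n // mulr1; congr (_ + _).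
  rewrite coefM scaler_sumr -sumrN exchange_big /=; apply: eq_bigr => a _.
  rewrite logdiff_coef ?leq_subr // -scaler_sumr -mulr_sumr sumrB.
  by rewrite -scalerAr scalerA scaleNr.
(* Index 0 holds the normalized x_i, the other r indices the basis rows of Q. *)
pose Z i (s : 'I_r.+1) e : 'rV[K]_n :=
  if unlift ord0 s is Some t then row (g t) (evmx Q e)
  else (al i).[e]^-1 *: row i (evmx P e).
have Zrat i s j : rational_fun (fun e => Z i s e 0 j).
  rewrite /Z; case: unliftP => [t _|_].
    apply: rational_ext (rational_horner (Q (g t) j)) => e.
    by rewrite !mxE.
  apply: rational_ext (rationalM (rationalV (rational_horner (al i)))
    (rational_horner (P i j))) => e.
  by rewrite !mxE.
have Xcomb i : ratcomb (fun s e => linform (Z i s e)) (X i).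
  exists (fun s => fun=> (s == ord0)%:R); split=> [s|e]; first exact: rational_cst.
  rewrite big_ord_recl eqxx scale1r big1 ?addr0 => [|t _].
    by rewrite /Z unlift_none.
  by rewrite -[_ == _]/false scale0r.
have Ycomb i i' : ratcomb (fun s e => linform (Z i s e)) (Y i').
  exists (fun s e => if unlift ord0 s is Some t then (be i').[e]^-1 * c i' t e else 0).
  split=> [s|e].
    case: unliftP => [t _|_]; last exact: rational_cst.
    apply: rationalM => //; apply: rationalV; exact: rational_horner.
  rewrite big_ord_recl unlift_none scale0r add0r /Y linformZ linform_sum scaler_sumr.
  by apply: eq_bigr => t _; rewrite /Z liftK linformZ scalerA.
have Wrat : rational_fun w.
  apply: rational_ext (rationalV (rational_horner 'X^M)) => e.
  by rewrite hornerXn.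
have Gspan i : powspan d (fun s e => linform (Z i s e)) d (G i).
  apply: powspanD.
    apply: powspanZ; last exact: powspan_prod1X.
    apply: rationalM; last exact: rational_cst.
    by apply: rationalM => //; apply: rationalD; exact: rational_horner.
  apply: powspan_sum => a _; apply: powspanZ.
    rewrite /co; apply: rational_ext (rationalM (rational_horner (- B))
      (rationalM (rational_cst (d - a)%:R^-1)
        (rationalM Wrat (rational_cst ((-1) ^+ (d - a).-1))))) => e.
    by rewrite hornerN mulNr.
  have ad : (a <= d)%N by rewrite -ltnS.
  have Qa : powspan d (fun s e => linform (Z i s e)) a (fun e => (QY e)`_a).
    exact: powspan_prod1X.
  have pw x : ratcomb (fun s e => linform (Z i s e)) x ->
      powspan d (fun s e => linform (Z i s e)) d (fun e => x e ^+ (d - a) * (QY e)`_a).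
    move=> xc; have := powspan_mul_ratcombX (m := d - a) (j := a) _ xc Qa.
    by rewrite subnKC //; apply.
  apply: powspan_ext (powspanD (pw _ (Xcomb i))
    (powspanZ (rational_cst (-1)) (pw _ (Ycomb i i)))) => e.
  by rewrite scaleN1r mulrBr ![_ * (QY e)`_a]mulrC.
have := powspan_border_waring d_gt0 Zrat Gspan limG.
by rewrite card_ord.
Qed.

End PoleCase.

(** * Final count and comparison of pole orders *)

Section Main.
Variables (K : numClosedFieldType) (k : nat).

Lemma waring_count_le d r : (0 < d)%N -> (0 < k)%N -> (r <= k)%N ->
  (d * (d.+1 ^ r.+1 * d.+1) <= 2 ^ k.+2 * d ^ (3 * k + 2))%N.
Proof.
move=> d0 k0 rk; rewrite -expnSr.
have d2 : (d.+1 <= 2 * d)%N by lia.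
apply: (@leq_trans (d * (2 * d) ^ k.+2)).
  rewrite leq_mul2l; apply/orP; right; apply: (@leq_trans (d.+1 ^ k.+2)).
    by rewrite leq_pexp2l // !ltnS.
  by rewrite leq_exp2r.
rewrite expnMn mulnCA leq_mul2l -expnS; apply/orP; right.
(* The exponent reached is k + 3, at most 3k + 2 because k is at least 1. *)
by rewrite leq_pexp2l //; lia.
Qed.

Lemma border_waring_rank_le n d (f : {mpoly K[n]}) r :
  border_waring_decomp d f r ->
  exists s, is_border_waring_rank d f s /\ (s <= r)%N.
Proof.
move=> fr; pose D s := `[< border_waring_decomp d f s >].
have exD : exists s, D s by exists r; apply/asboolP.
case: (ex_minnP exD) => s /asboolP sD s_min; exists s; split.
  by split=> // t tD; apply: s_min; apply/asboolP.
by apply: s_min; apply/asboolP.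
Qed.

Theorem border_RB_cases n d (f : {mpoly K[n]}) : (0 < k)%N ->
  f \is d.-homog -> border_RB d k f ->
  RB d k f \/ exists r, is_border_waring_rank d f r /\
    (r <= 2 ^ k.+2 * d ^ (3 * k + 2))%N.
Proof.
move=> k0 f_homog [L [L' [LL LL' rL' limf]]].
(* A single product with a pole is impossible: subtracting the convergent one would make it
   converge. *)
have no_pole z (H F E : K -> {mpoly K[n]}) H0 e0 :
    (z < 0)%R -> H0 != 0 -> poly_lim0 H H0 ->
    (forall e, e != 0 -> E e = e ^ z *: H e) ->
    poly_lim0 F e0 -> poly_lim0 (fun e => F e + E e) f -> False.
  move=> z0 H0n HH0 EE Fe FE; apply: (pole_not_cvgp z0 H0n HH0).
  exists (f - e0); apply: poly_lim0_near (poly_lim0B FE Fe).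
  by apply: filterS (near0_neq0 K) => e en; rewrite EE // addrC addKr.
have prodn0 m (R : 'M[{poly K}]_(m, n)) : (forall i, row i (evmx R 0) != 0) ->
    prodform (evmx R 0) != 0.
  by move=> R0; apply/prodf_neq0 => i _; apply: linform_neq0.
case: (laurent_product_cases LL) => [[N [_ limN]]|[z [P [[z0 d0] P0 LP _]]]];
case: (laurent_product_cases LL') => [[N' [rN' limN']]|[z' [Q [[z'0 _] Q0 LQ rQ]]]].
- left; exists N, N'; split; first exact: rN'.
  exact: poly_lim0_unique limf (poly_lim0D limN limN').
- case: (no_pole z' _ _ _ _ _ z'0 (prodn0 _ _ Q0) (@poly_lim0_prodform _ _ _ Q) LQ limN limf).
- case: (no_pole z _ _ _ _ _ z0 (prodn0 _ _ P0) (@poly_lim0_prodform _ _ _ P) LP limN').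
  by apply: poly_lim0_ext limf => e; rewrite addrC.
(* For unequal orders, factoring out the deeper pole e^a makes the other product vanish in the
   limit, so the nonzero leading product cannot be cancelled. *)
have unequal (a b : int) (R S : 'M[{poly K}]_(d, n)) :
    (forall i, row i (evmx R 0) != 0) -> (a < 0)%R -> (a < b)%R ->
    poly_lim0 (fun e => e ^ a *: prodform (evmx R e) + e ^ b *: prodform (evmx S e)) f ->
    False.
  move=> R0 a0 ab lim.
  have [N N0 bE] : exists2 N, (0 < N)%N & b = a + N%:Z by exists `|b - a|%N; lia.
  have hS := nullpZl (cvg0_expn0 N0) (ex_intro _ _ (@poly_lim0_prodform _ _ _ S)).
  have := poly_lim0D (@poly_lim0_prodform _ _ _ R) hS; rewrite addr0 => h.
  apply: (pole_not_cvgp a0 (prodn0 _ _ R0) h); exists f.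
  apply: poly_lim0_near lim; apply: filterS (near0_neq0 K) => e e0.
  by rewrite bE scalerDr scalerA expfzDr.
have limPQ : poly_lim0 (fun e =>
    e ^ z *: prodform (evmx P e) + e ^ z' *: prodform (evmx Q e)) f.
  apply: poly_lim0_near limf; apply: filterS (near0_neq0 K) => e e0.
  by rewrite LP // LQ.
have rankQ e : e != 0 -> (\rank (evmx Q e) <= k)%N.
  by move=> e0; exact: leq_trans (rQ e e0) (rL' e e0).
case: (ltrgtP z z') => zz'.
- by case: (unequal z z' P Q).
- case: (unequal z' z Q P) => //.
  by apply: poly_lim0_ext limPQ => e; rewrite addrC.
have [M M0 zE] : exists2 M, (0 < M)%N & z = - M%:Z by exists `|z|%N; lia.
have limM : poly_lim0
    (fun e => (e ^+ M)^-1 *: (prodform (evmx P e) + prodform (evmx Q e))) f.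
  by apply: poly_lim0_ext limPQ => e; rewrite -zz' zE -exprnN scalerDr.
have [r rk fr] := pole_case d0 M0 f_homog P0 Q0 rankQ limM.
have [s [sD sr]] := border_waring_rank_le fr.
by right; exists s; split=> //; exact: leq_trans sr (waring_count_le d0 k0 rk).
Qed.

End Main.

Theorem mainTheorem5 (R : realType) (k : nat) (hk : (1 <= k)%N) :
  exists C : nat,
    forall (n d : nat) (f : {mpoly R[i][n]}),
      f \is d.-homog ->
      border_RB d k f ->
      RB d k f \/
      exists r : nat,
        is_border_waring_rank d f r /\ (r <= C * d ^ (3 * k + 2))%N.
Proof.
(* The constant comes from bounding d + 1 by 2d in the power k + 2. *)
exists (2 ^ k.+2)%N => n d f f_homog fB; exact: border_RB_cases.
Qed.
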